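(* Let $\chi$ be a finite or countable alphabet, let $\mu,\nu$ be stationary probability measures on $\chi^{\mathbb{N}}$, and let $0<\epsilon<1$. Suppose that for some integer $g\ge0$ there exist constants $K>0$ and $\delta>0$ such that $\log\psi_g^+(i,j)\le K\,\frac{i+j}{[\log(i+j)]^{1+\delta}}$ for all integers $i,j\ge1$, and suppose that $\nu$ has complete grammar. Then the limits $\mathcal{R}$ and $\Delta(\epsilon)$ exist and $$\Delta(\epsilon)=\epsilon\,\mathcal{R}.$$
   Context: $\sigma$ is the left shift on $\chi^{\mathbb{N}}$, $\mathbb{N}=\{0,1,2,\dots\}$, and $x_m^n=x_mx_{m+1}\cdots x_n$. A string $\omega\in\chi^n$ is identified with the cylinder $\{\mathbf{x}\in\chi^{\mathbb{N}}: x_0^{n-1}=\omega\}$; $\mu\nu(\omega)=\mu(\omega)\nu(\omega)$. Stationary means $\sigma$-invariant, and $\mathbb{P}=\mu\times\nu$. The measure $\nu$ has complete grammar if $\nu(\omega)>0$ for all $n\ge1$ and all $\omega\in\chi^n$. Shortest-path function: $T_n^{(2)}(\mathbf{x},\mathbf{y})=\inf\{k\ge 1: y_0^{n-1}\cap\sigma^{-k}(x_0^{n-1})\ne\emptyset\}$. For the measure $\mu$ set $\psi_{\mu,g}^+(i,j)=\sup_{\omega\in\chi^i,\ \xi\in\chi^j}\frac{\mu(\sigma^{-(i+g)}\xi\mid\omega)}{\mu(\xi)}$ (supremum over strings of positive $\mu$-measure), define $\psi_{\nu,g}^+$ in the same way, and $\psi_g^+=\max\{\psi_{\mu,g}^+,\psi_{\nu,g}^+\}$.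 $k$-divergence: $\mathbb{E}_{\mu,\nu}(k)=\sum_{\omega\in\chi^k}\mu\nu(\omega)$. Limiting rate: $\mathcal{R}=\lim_{k\to\infty}\left(-\frac1k\log\mathbb{E}_{\mu,\nu}(k)\right)$. Lower deviation rate: $\Delta(\epsilon)=\lim_{n\to\infty}\frac1n\left|\log\mathbb{P}\left(\frac{T_n^{(2)}}{n}<1-\epsilon\right)\right|$. Both take values in $[0,\infty]$ when the limits exist, with $|\log 0|=+\infty$. *)

(* Defs.v *)
From HB Require Import structures.
From mathcomp Require Export all_boot all_order all_algebra.
From mathcomp Require Export all_classical all_reals all_analysis.
Export numFieldNormedType.Exports.

Set Implicit Arguments.
Unset Strict Implicit.
Unset Printing Implicit Defensive.
Import Order.TTheory GRing.Theory Num.Theory.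

Local Open Scope classical_set_scope.
Local Open Scope ring_scope.
Local Open Scope ereal_scope.

Section sequences.
Variable chi : Type.

Definition left_shift (x : nat -> chi) : nat -> chi := fun i => x i.+1.

(* x_0 x_1 ... x_{n-1} *)
Definition init_word (n : nat) (x : nat -> chi) : n.-tuple chi :=
  [tuple x i | i < n].

Definition cylinder (n : nat) (w : n.-tuple chi) : set (nat -> chi) :=
  [set x | init_word n x = w].

Definition cylinders : set (set (nat -> chi)) :=
  [set A | exists n (w : n.-tuple chi), A = cylinder w].

End sequences.

(* The alphabet is a pointedType because the library's measurable types are
   inhabited; an alphabet whose sequence space carries a probability is
   nonempty anyway. *)
Definition seq_space (chi : pointedType) := g_sigma_algebraType (@cylinders chi).

Section measures.
Variables (R : realType) (chi : pointedType).
Implicit Types mu nu : probability (seq_space chi) R.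

Definition stationary mu :=
  forall A : set (seq_space chi), measurable A ->
    mu (@left_shift chi @^-1` A) = mu A.

Definition complete_grammar mu :=
  forall (n : nat) (w : n.-tuple chi), (1 <= n)%N -> 0 < mu (cylinder w).

Definition cond_proba mu (A B : set (seq_space chi)) : \bar R :=
  mu (A `&` B) / mu B.

Definition psi_plus mu (g i j : nat) : \bar R :=
  ereal_sup [set r | exists (w : i.-tuple chi) (xi : j.-tuple chi),
    [/\ 0 < mu (cylinder w), 0 < mu (cylinder xi) &
        r = cond_proba mu (iter (i + g) (@left_shift chi) @^-1` cylinder xi)
                          (cylinder w) / mu (cylinder xi)]].

Definition psi_plus_max mu nu (g i j : nat) : \bar R :=
  maxe (psi_plus mu g i j) (psi_plus nu g i j).

Definition shortest_path (n : nat) (x y : nat -> chi) : R :=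
  inf [set k%:R | k in [set k : nat | (1 <= k)%N /\
    cylinder (init_word n y) `&`
      (iter k (@left_shift chi) @^-1` cylinder (init_word n x)) !=set0]].

Definition divergence mu nu (k : nat) : \bar R :=
  \esum_(w in [set: k.-tuple chi]) (mu (cylinder w) * nu (cylinder w)).

(* lne 0 = -oo and `|-oo| = +oo, so both sequences below live in [0, +oo] and
   their limits are taken in the extended reals. *)
Definition rate_seq mu nu (k : nat) : \bar R :=
  - ((k%:R^-1)%:E * lne (divergence mu nu k)).

Definition limiting_rate mu nu : \bar R := limn (rate_seq mu nu).

Definition deviation_seq mu nu (eps : R) (n : nat) : \bar R :=
  (n%:R^-1)%:E *
  `| lne ((mu \x nu) [set xy : seq_space chi * seq_space chi |
                       (shortest_path n xy.1 xy.2 / n%:R < 1 - eps)%R]) |.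

Definition lower_deviation_rate mu nu (eps : R) : \bar R :=
  limn (deviation_seq mu nu eps).

End measures.

(* Main.v *)
(* Two words match along [k] letters with probability [E k = divergence mu nu k].
   A deviation [T_n < (1 - eps) n] means that, for some shift [k >= 1], the last
   [n - k > eps n] letters of [y] match the first ones of [x].  With
   [m = trunc (eps n) + 1] a union bound gives [E m <= P <= n * E m], so that the
   deviation rate is [eps] times the limit of [- ln (E m) / m], if that exists.

   Forgetting the [g] middle letters gives
   [E (i + g + j) <= psi i j ^ 2 * E i * E j], so [- ln E] is superadditive up
   to the gap and to an error whose dyadic values are summable relative to the
   length; cutting words into halves shows that [- ln (E k) / k] converges in
   [[0, +oo]]. *)

From mathcomp Require Import ring lra zify.
Require Import Defs.

Import Order.TTheory GRing.Theory Num.Theory.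
Local Open Scope classical_set_scope.
Local Open Scope ring_scope.
Local Open Scope ereal_scope.

(** * Nearly superadditive sequences *)

(** Letting [n] and then [m] tend to infinity gives [limsup u <= liminf u + e]. Convergence is in
    the extended reals, since [u] may tend to [+oo]. *)
Lemma asymptotically_nondecreasing_cvg (R : realType) (u : nat -> R) :
  (forall e : R, (0 < e)%R ->
     \forall m \near \oo, \forall n \near \oo, (u m - e <= u n)%R) ->
  cvgn (EFin \o u).
Proof.
move=> hu; pose v := EFin \o u.
have le_sup_inf : limn_esup v <= limn_einf v.
  apply/lee_addgt0Pr => e e0.
  have [N _ HN] := hu _ e0.
  have Hm m : (N <= m)%N -> v m <= limn_einf v + e%:E.
    move=> /HN [N' _ HN'].
    rewrite -leeBlDr// limn_einf_lim; apply: lime_ge; first exact: is_cvg_einfs.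
    exists N' => // k /= Nk.
    rewrite /einfs; apply: le_ereal_inf_tmp => _ [n /= kn <-].
    by rewrite /v /= -EFinB lee_fin; apply: HN'; rewrite /= (leq_trans Nk).
  rewrite limn_esup_lim; apply: lime_le; first exact: is_cvg_esups.
  exists N => // k /= Nk; apply: ge_ereal_sup => _ [n /= kn <-].
  by apply: Hm; rewrite (leq_trans Nk).
have E : limn_einf v = limn_esup v.
  by apply/eqP; rewrite eq_le limn_einf_sup.
apply/cvg_ex; exists (limn_einf v).
apply: (@squeeze_cvge _ _ _ _ (einfs v) _ (esups v)).
- apply: nearW => n; apply/andP; split.
  + by apply: ereal_inf_lbound; exists n => /=.
  + by apply: ereal_sup_ubound; exists n => /=.
- by rewrite limn_einf_lim; exact: is_cvg_einfs.
- by rewrite E limn_esup_lim; exact: is_cvg_esups.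
Qed.

Section nearly_superadditive.
Local Open Scope ring_scope.
Variables (R : realType) (h a : nat -> R) (n0 : nat).
Hypothesis h_ge0 : forall n, 0 <= h n.
Hypothesis h_homo : {homo h : m n / (m <= n)%N >-> m <= n}.
Hypothesis a_ge0 : forall s, 0 <= a s.
(** The relative error is indexed by a dyadic level [s] of the total length, so that repeated
    halving meets each level once and the errors add up to a series. *)
Hypothesis h_super : forall i j s, (n0 <= i)%N -> (n0 <= j)%N ->
  (2 ^ s.+2 <= i + j)%N -> h i + h j - (i + j)%:R * a s <= h (i + j)%N.

(* Splitting [q] blocks of length [M] into halves again and again costs at most
   [q M a (m + s)] at the level where the pieces have [2 ^ s] blocks. *)
Lemma halving_lower_bound (M m k q : nat) :
  (n0 <= M)%N -> (2 ^ m.+2 <= M)%N -> (2 ^ k <= q <= 2 ^ k.+1)%N ->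
  q%:R * h M - (q * M)%:R * (\sum_(0 <= s < k.+1) a (m + s)) <= h (q * M)%N.
Proof.
move=> n0M mM; elim: k q => [|k IH] q /andP[kq qk].
  rewrite big_nat1 addn0; have [->|->] : q = 1%N \/ q = 2%N by lia.
    by rewrite !mul1n mul1r; have := mulr_ge0 (ler0n R M) (a_ge0 m); lra.
  rewrite mul2n -addnn.
  have := h_super _ _ _ n0M n0M (leq_trans mM (leq_addr _ _)).
  lra.
pose q1 := (q %/ 2)%N; pose q2 := (q - q1)%N.
have e2 : (2 ^ k.+2 = 4 * 2 ^ k)%N by rewrite !expnS; lia.
have e1 : (2 ^ k.+1 = 2 * 2 ^ k)%N by rewrite !expnS; lia.
have q1q2 : (q1 + q2 = q)%N by rewrite /q1 /q2; lia.
have q1k : (2 ^ k <= q1 <= 2 ^ k.+1)%N by rewrite /q1; lia.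
have q2k : (2 ^ k <= q2 <= 2 ^ k.+1)%N by rewrite /q2 /q1; lia.
have h1 := IH _ q1k; have h2 := IH _ q2k.
have k0 : (0 < 2 ^ k)%N by rewrite expn_gt0.
have n0q1 : (n0 <= q1 * M)%N by rewrite (leq_trans n0M)// leq_pmull//; lia.
have n0q2 : (n0 <= q2 * M)%N by rewrite (leq_trans n0M)// leq_pmull//; lia.
(* The last gluing has total length [q M >= 2 ^ (k + 1) * 2 ^ (m + 2)], so it costs
   [q M a (m + k + 1)], the new term of the sum. *)
have sq : (2 ^ (m + k.+1).+2 <= q1 * M + q2 * M)%N.
  by rewrite -mulnDl q1q2 -addSn -addSn addnC expnD leq_mul.
have := h_super _ _ _ n0q1 n0q2 sq; rewrite -mulnDl q1q2 => h12.
rewrite big_nat_recr//=.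
move: h1 h2 h12; rewrite -q1q2 mulnDl !natrD.
set S := \sum_(0 <= s < k.+1) _; set A1 := a _; nra.
Qed.

Hypothesis a_summable : cvgn (series a).

(** Uniformity in [k] makes the cost of halving independent of the number of halvings. *)
Lemma series_tail_le (e : R) : 0 < e ->
  exists m, forall k, \sum_(0 <= s < k) a (m + s) <= e.
Proof.
move=> e0.
have nd : nondecreasing_seq (series a).
  by apply/nondecreasing_seqP => n; rewrite seriesSr lerDl.
have /cvgrPdist_le /(_ _ e0)[m _ Hm] := a_summable.
exists m => k.
have E : series a (m + k) = series a m + \sum_(0 <= s < k) a (m + s).
  rewrite /series /= (@big_cat_nat _ _ _ m)//= ?leq_addr//.
  by congr (_ + _); rewrite -{1}(add0n m) big_addn addKn;
    apply: eq_bigr => i _; rewrite addnC.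
have := nondecreasing_cvgn_le nd a_summable (m + k).
have := Hm m (leqnn m); rewrite E.
have := nondecreasing_cvgn_le nd a_summable m.
rewrite /= => h1; rewrite ger0_norm ?subr_ge0//; lra.
Qed.

(** For [M] large and [n = q M + r], monotonicity replaces [n] by [q M]. Halving the [q] blocks
    costs at most [n e / 2], and the lost remainder costs at most [h M <= n e / 2]. *)
Lemma nearly_superadditive_cvg : cvgn (fun n => (h n / n%:R)%:E).
Proof.
apply: (@asymptotically_nondecreasing_cvg _ (fun n => h n / n%:R)) => e e0.
have e20 : 0 < e / 2 by lra.
have [m Hm] := series_tail_le _ e20.
exists (maxn n0 (2 ^ m.+2)) => // M /=; rewrite geq_max => /andP[n0M mM].
have M0 : (0 < M)%N by rewrite (leq_trans _ mM)// expn_gt0.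
have M0R : 0 < M%:R :> R by rewrite ltr0n.
have hM0 := h_ge0 M.
(* The second term forces [h M <= (e / 2) n]. *)
pose N := maxn M (Num.trunc (h M / (e / 2))).+1.
exists N => // n /=; rewrite geq_max => /andP[Mn Nn].
have n0R : 0 < n%:R :> R by rewrite ltr0n (leq_trans M0).
have hMn : h M <= (e / 2) * n%:R.
  rewrite mulrC -ler_pdivrMr// ltW//.
  by rewrite -truncn_lt_nat// divr_ge0// ltW.
pose q := (n %/ M)%N.
have q0 : (0 < q)%N by rewrite divn_gt0.
have qMn : (q * M <= n)%N by exact: leq_trunc_div.
have nqM : (n <= q * M + M)%N.
  by rewrite addnC -mulSn ltnW// ltn_ceil.
have [k Hk] : exists k, (2 ^ k <= q <= 2 ^ k.+1)%N.
  exists (trunc_log 2 q); rewrite trunc_logP//= ltnW//.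
  exact: trunc_log_ltn.
have := halving_lower_bound _ _ _ _ n0M mM Hk.
set S := \sum_(_ <= _ < _) _; have SS : S <= e / 2 by exact: Hm.
have := h_homo _ _ qMn.
rewrite -(ler_nat R) natrD in nqM; rewrite -(ler_nat R) in qMn.
rewrite natrM in nqM qMn *.
set Q : R := q%:R in nqM qMn * => h1 h2.
rewrite ler_pdivlMr// mulrBl.
have vM : h M / M%:R * M%:R = h M by rewrite divfK// gt_eqF.
have v0 : 0 <= h M / M%:R by rewrite divr_ge0.
set v := h M / M%:R in vM v0 *.
have Q0 : 0 <= Q by rewrite /Q ler0n.
have : v * n%:R <= Q * h M + h M.
  by rewrite -[in leRHS]vM; nra.
have : Q * M%:R * S <= n%:R * (e / 2).
  by apply: (@le_trans _ _ (Q * M%:R * (e / 2)));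
    [rewrite ler_wpM2l// mulr_ge0 | rewrite ler_wpM2r// ltW].
lra.
Qed.

End nearly_superadditive.

(** * Convergence of the series of powers with exponent below [-1] *)

Section power_series.
Local Open Scope ring_scope.
Variables (R : realType) (d : R).
Hypothesis d0 : 0 < d.

(* [1 + d t <= (1 - t) ^ (- d)] at [t = 1 / (j + 2)] *)
Lemma powR_telescope (j : nat) :
  d * j.+2%:R `^ (- (1 + d)) <= j.+1%:R `^ (- d) - j.+2%:R `^ (- d).
Proof.
set x : R := j.+1%:R; set y : R := j.+2%:R.
have x0 : 0 < x by rewrite ltr0n.
have y0 : 0 < y by rewrite ltr0n.
have xy : y = x + 1 by rewrite /x /y -natr1.
have yd0 : 0 <= y `^ (- d) by exact: powR_ge0.
have -> : y `^ (- (1 + d)) = y `^ (- d) / y.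
  rewrite opprD addrC powRD; last by rewrite (gt_eqF y0) implybT.
  by rewrite powR_inv1// ltW.
have -> : x `^ (- d) = y `^ (- d) * (x / y) `^ (- d).
  by rewrite -powRM ?divr_ge0 1?ltW//; congr (_ `^ _); rewrite mulrC divfK// gt_eqF.
(* Here [x / y = 1 - t] with [t = 1 / y]; use [(1 - t) ^ (- d) = exp (- d ln (1 - t))],
   [exp u >= 1 + u] and [ln (1 - t) <= - t]. *)
have : 1 + d / y <= (x / y) `^ (- d).
  rewrite /powR gt_eqF ?divr_gt0//.
  apply: le_trans (expR_ge1Dx _); rewrite lerD2l.
  have : ln (1 + (- y^-1)) <= - y^-1.
    by apply: le_ln1Dx; rewrite ltrN2 invf_lt1// /y ltr1n.
  have -> : 1 + - y^-1 = x / y by rewrite xy; field; apply: lt0r_neq0; lra.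
  by rewrite mulNr -mulrN ler_pM2l// lerNr.
by move=> /(ler_wpM2l yd0); rewrite mulrDr mulr1 mulrCA lerBrDl.
Qed.

(** Telescoping bounds the partial sums by [(d + 1) / d]; the summand [d] of the numerator pays for
    the term [j = 0]. *)
Lemma cvg_series_powR : cvgn (series (fun j => j.+1%:R `^ (- (1 + d)) : R)).
Proof.
set a := (fun j => _).
have a0 j : 0 <= a j by exact: powR_ge0.
have nd : nondecreasing_seq (series a).
  by apply/nondecreasing_seqP => n; rewrite seriesSr lerDl.
have B n : d * series a n.+1 <= d + 1 - n.+1%:R `^ (- d).
  elim: n => [|n IH].
    by rewrite seriesSr /series/= big_geq// /a !powR1; lra.
  rewrite seriesSr mulrDr; have := powR_telescope n; rewrite -/(a n.+1); lra.
apply: nondecreasing_is_cvgn => //.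
exists ((d + 1) / d) => _ [n _ <-].
rewrite ler_pdivlMr// mulrC.
apply: (@le_trans _ _ (d * series a n.+1)).
  by rewrite ler_pM2l//; apply: nd.
apply: (le_trans (B n)).
by rewrite gerBl powR_ge0.
Qed.

End power_series.

(** * Limits of ratios under a shift or a rescaling of the index *)

Section real_sequences.
Local Open Scope ring_scope.
Variable R : realType.

Lemma near_ge_nat (x : R) : \forall n \near \oo, x <= n%:R.
Proof.
exists (Num.trunc `|x|).+1 => // n /= xn.
rewrite (le_trans (ler_norm _))// ltW//.
by rewrite -truncn_lt_nat.
Qed.

Lemma cvg_ratio_near_linear (x : nat -> R) (c C : R) :
  (forall n, `|x n - c * n%:R| <= C) -> x n / n%:R @[n --> \oo] --> c.
Proof.
move=> xc; apply/cvgrPdist_le => e e0.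
near=> n.
have n0 : 0 < n%:R :> R.
  by apply: lt_le_trans ltr01 _; near: n; exact: near_ge_nat.
have -> : c - x n / n%:R = - ((x n - c * n%:R) / n%:R) by field; rewrite gt_eqF.
rewrite normrN normrM normfV (ger0_norm (ltW n0)) ler_pdivrMr//.
apply: (le_trans (xc n)); rewrite -ler_pdivrMl// mulrC.
by near: n; exact: near_ge_nat.
Unshelve. all: by end_near. Qed.

(** From [ln (c n) <= c n] with [c = e / 2] one gets [ln n <= c n - ln c], and [- ln c <= c n] for
    large [n]. *)
Lemma cvg_ln_div_nat : ln n%:R / n%:R @[n --> \oo] --> (0 : R).
Proof.
apply/cvgrPdist_le => e e0; near=> n.
have n1 : 1 <= n%:R :> R by near: n; exact: near_ge_nat.
have n0 : 0 < n%:R :> R by apply: lt_le_trans n1.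
have c0 : 0 < e / 2 by lra.
have cn : - ln (e / 2) <= (e / 2) * n%:R.
  by rewrite -ler_pdivrMl// mulrC; near: n; exact: near_ge_nat.
rewrite sub0r normrN ger0_norm; last by rewrite divr_ge0 ?ln_ge0// ltW.
rewrite ler_pdivrMr//.
have : ln (e / 2 * n%:R) <= e / 2 * n%:R by apply/ltW/ln_sublinear/mulr_gt0.
rewrite lnM ?posrE//; lra.
Unshelve. all: by end_near. Qed.

(** The correcting factor [(n + g) / n] tends to [1], so the product of limits is defined even for
    infinite [l]. *)
Lemma cvg_div_nat_shift (f : nat -> R) (g : nat) (l : \bar R) :
  (f n / (n + g)%:R)%:E @[n --> \oo] --> l -> (f n / n%:R)%:E @[n --> \oo] --> l.
Proof.
move=> fl.
have r1 : ((n + g)%:R / n%:R : R) @[n --> \oo] --> (1 : R).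
  apply: (@cvg_ratio_near_linear _ _ g%:R) => n.
  by rewrite mul1r natrD addrC addKr ger0_norm.
have : ((f n / (n + g)%:R)%:E * ((n + g)%:R / n%:R)%:E)%E @[n --> \oo] --> (l * 1)%E.
  apply: cvgeM => //; last by apply: cvg_EFin => //; exact: nearW.
  by rewrite mule_defE/= eqe oner_eq0/= andbF.
rewrite mule1; apply: cvg_trans; apply: near_eq_cvg; near=> n.
rewrite -EFinM; congr (_%:E).
have n0 : (0 < n)%N by near: n; exact: nbhs_infty_gt.
by field; rewrite -natrD !pnatr_eq0; lia.
Unshelve. all: by end_near. Qed.

(* The gap is absorbed by the shift [h n = f (n - g)]. *)
Lemma gapped_superadditive_cvg (f : nat -> R) (g : nat) (K d : R) :
  0 <= K -> 0 < d -> (forall n, 0 <= f n) -> {homo f : m n / (m <= n)%N >-> m <= n} ->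
  (forall i j, (1 <= i)%N -> (1 <= j)%N ->
     f i + f j - K * ((i + j)%:R / ln ((i + j)%:R) `^ (1 + d)) <= f (i + g + j)%N) ->
  cvgn (fun n => (f n / n%:R)%:E).
Proof.
move=> K0 d0 f0 fh fs.
pose h n := f (n - g)%N.
have ln20 : 0 < ln 2 :> R by rewrite ln_gt0// ltr1n.
(* At lengths [t >= 2 ^ (s + 1)] one has [ln t >= (s + 1) ln 2], hence [K / (ln t) ^ (1 + d) <= a s]
   with [a] as below. *)
pose c := K * ln 2 `^ (- (1 + d)).
have c0 : 0 <= c by rewrite mulr_ge0// powR_ge0.
pose a s := c * s.+1%:R `^ (- (1 + d)).
suff : cvgn (fun n => (h n / n%:R)%:E).
  move=> /cvg_ex[l hl]; apply/cvg_ex; exists l; apply: (@cvg_div_nat_shift f g).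
  move: hl; rewrite -(cvg_shiftn g); apply: cvg_trans; apply: near_eq_cvg.
  by apply: nearW => n /=; rewrite /h addnK.
(* With [i, j >= 2 g + 1] both [i - g] and [j - g] are positive, and [i + j - 2 g] is at least half
   of [i + j], which turns [2 ^ (s + 2)] into [2 ^ (s + 1)]. *)
apply: (@nearly_superadditive_cvg _ h a (2 * g).+1).
  by move=> n; exact: f0.
  by move=> m n mn; apply: fh; rewrite leq_sub2r.
  by move=> s; rewrite mulr_ge0// powR_ge0.
2: {
  have -> : series a = (fun n => c * series (fun j => j.+1%:R `^ (- (1 + d))) n).
    by apply/funext => n; rewrite /series/= big_distrr.
  by apply: is_cvgMr; exact: cvg_series_powR.
}
move=> i j s gi gj sij.
have i1 : (1 <= i - g)%N by lia.
have j1 : (1 <= j - g)%N by lia.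
have := fs _ _ i1 j1.
have -> : (i - g + g + (j - g) = i + j - g)%N by lia.
set t := (i - g + (j - g))%N; rewrite -/(h i) -/(h j) -/(h (i + j)%N).
apply: le_trans; rewrite lerD2l lerN2.
have ts : (2 ^ s.+1 <= t)%N by move: sij; rewrite /t expnS; lia.
have lt : s.+1%:R * ln 2 <= ln t%:R :> R.
  rewrite mulr_natl -lnXn; last by rewrite ltr0n.
  rewrite -natrX ler_ln ?posrE ?ltr0n ?ler_nat// ?expn_gt0//.
  by rewrite (leq_trans _ ts)// expn_gt0.
have s0 : 0 < s.+1%:R * ln 2 :> R by rewrite mulr_gt0// ltr0n.
have d1 : 0 <= 1 + d by lra.
have -> : (i + j)%:R * a s = K * ((i + j)%:R / (s.+1%:R * ln 2) `^ (1 + d)).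
  rewrite /a /c !powRN powRM//; last by rewrite ltW.
  by rewrite invfM; ring.
rewrite ler_wpM2l// ler_pM ?invr_ge0 ?powR_ge0//.
  by rewrite ler_nat /t; lia.
rewrite lef_pV2 ?posrE ?powR_gt0//; last exact: lt_le_trans lt.
by rewrite ge0_ler_powR// nnegrE ltW// (lt_le_trans s0).
Qed.

(** Since [m n / n] tends to [eps], the product of [m n / n] and [f (m n) / m n] tends to [eps l].
    Subtracting [ln n / n] does not change this limit, and [D n / n] is squeezed. *)
Lemma cvg_fraction (f D : nat -> R) (eps : R) (l : \bar R)
    (m := fun n => (Num.trunc (eps * n%:R)).+1) :
  0 < eps -> (f n / n%:R)%:E @[n --> \oo] --> l ->
  (\forall n \near \oo, f (m n) - ln n%:R <= D n <= f (m n)) ->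
  (D n / n%:R)%:E @[n --> \oo] --> (eps%:E * l)%E.
Proof.
move=> eps0 fl Df.
have trE n : (Num.trunc (eps * n%:R))%:R <= eps * n%:R < (m n)%:R.
  by apply: truncn_itv; rewrite mulr_ge0// ltW.
have mn : (m n)%:R / n%:R @[n --> \oo] --> eps.
  apply: (@cvg_ratio_near_linear _ _ 1) => n.
  have /andP[] := trE n; rewrite /m -natr1 => h1 h2.
  by rewrite ler_norml; apply/andP; split; lra.
have moo : m n @[n --> \oo] --> \oo.
  apply/cvgnyPge => A; near=> n.
  rewrite -(ler_nat R); have /andP[_ /ltW] := trE n; apply: le_trans.
  by rewrite -ler_pdivrMl// mulrC; near: n; exact: near_ge_nat.
have ul : (f (m n) / (m n)%:R)%:E @[n --> \oo] --> l.
  exact: (cvg_comp _ _ moo fl).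
(* As [eps] is nonzero, the product makes sense for [l = +oo] too. *)
have el : eps%:E *? l by rewrite mule_defE/= eqe (gt_eqF eps0)/= andbF.
have fm : (f (m n) / n%:R)%:E @[n --> \oo] --> (eps%:E * l)%E.
  have : (((m n)%:R / n%:R)%:E * (f (m n) / (m n)%:R)%:E)%E @[n --> \oo]
      --> (eps%:E * l)%E.
    by apply: cvgeM => //; apply: cvg_EFin => //; exact: nearW.
  apply: cvg_trans; apply: near_eq_cvg; near=> n.
  rewrite -EFinM; congr (_%:E).
  have n0 : (0 < n)%N by near: n; exact: nbhs_infty_gt.
  by field; rewrite ?pnatr_eq0 /m; lia.
have fml : ((f (m n) / n%:R)%:E - (ln n%:R / n%:R)%:E)%E @[n --> \oo] --> (eps%:E * l)%E.
  rewrite -[X in _ --> X]sube0; apply: cvgeB => //.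
    by rewrite fin_num_adde_defl.
  by apply: cvg_EFin; [exact: nearW|exact: cvg_ln_div_nat].
apply: squeeze_cvge fml fm.
near=> n.
have n0 : 0 < n%:R :> R by rewrite ltr0n; near: n; exact: nbhs_infty_gt.
rewrite -EFinB !lee_fin -mulrBl !ler_pM2r ?invr_gt0//.
by near: n.
Unshelve. all: by end_near. Qed.

End real_sequences.

(** * Cylinders and divergence *)

Section countable_sums.
Variables (R : realType) (I : choiceType).

Lemma esumZl_le (c : R) (b : I -> \bar R) :
  (0 <= c)%R -> (forall i, 0 <= b i) ->
  \esum_(i in [set: I]) (c%:E * b i) <= c%:E * \esum_(i in [set: I]) b i.
Proof.
move=> c0 b0; apply: ge_ereal_sup => _ [X [finX XT] <-].
rewrite -ge0_mule_fsumr//; apply: lee_wpmul2l; first by rewrite lee_fin.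
by apply: ereal_sup_ubound; exists X.
Qed.

(** An injection [f] of [I] into [nat] reduces this to sigma-additivity over [range f], where
    [G (f i)] is the single set [F i]. *)
Lemma measure_countable_bigcup d (T : measurableType d)
    (m : {measure set T -> \bar R}) (F : I -> set T) :
  countable [set: I] -> (forall i, measurable (F i)) -> trivIset setT F ->
  m (\bigcup_i F i) = \esum_(i in [set: I]) m (F i).
Proof.
move=> /countable_injP[f finj] mF tF.
have fI i j : f i = f j -> i = j by apply: finj; rewrite inE.
pose G n := \bigcup_(i in f @^-1` [set n]) F i.
have GE i : G (f i) = F i.
  apply/seteqP; split => [x [j /= /fI -> //]|x Fx]; by exists i.
have -> : \bigcup_i F i = \bigcup_(n in range f) G n.
  apply/seteqP; split => [x [i _ Fx]|x [_ [i _ <-]]].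
    by exists (f i); [exists i|rewrite GE].
  by rewrite GE => Fx; exists i.
rewrite measure_bigcup; first last.
- move=> n1 n2 _ _ [x [[i /= <- Fi] [j /= <- Fj]]].
  by congr f; apply: tF => //; exists x.
- by move=> _ [i _ <-]; rewrite GE.
rewrite nneseries_esum// set_mem_set esum_image; last by move=> i j _ _; exact: fI.
by apply: eq_esum => i _; rewrite GE.
Qed.

End countable_sums.

(** * Countability of words and measurability of events on finitely many letters *)

Section words.
Variables (chi : pointedType).
Hypothesis chi_countable : countable [set: chi].

Lemma countable_words n : countable [set: n.-tuple chi].
Proof.
have /countable_injP[f finj] := chi_countable.
apply/countable_injP; exists (fun w => choice.pickle (map f w)) => u v _ _.
move=> /(pcan_inj choice.pickleK) /inj_map uv; apply/val_inj/uv => a b.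
by apply: finj; rewrite inE.
Qed.

Lemma countable_word_pairs i j : countable [set: i.-tuple chi * j.-tuple chi].
Proof.
have /countable_injP[f finj] := countable_words i.
have /countable_injP[h hinj] := countable_words j.
apply/countable_injP; exists (fun u => choice.pickle (f u.1, h u.2)).
move=> [u1 u2] [v1 v2] _ _ /(pcan_inj choice.pickleK)[].
by move=> /finj e1 /hinj e2; rewrite e1 ?inE// e2 ?inE.
Qed.

Lemma init_wordP n (x y : nat -> chi) :
  init_word n x = init_word n y <-> (forall i, (i < n)%N -> x i = y i).
Proof.
split=> [xy i iN|xy].
  by have := congr1 (fun t => tnth t (Ordinal iN)) xy; rewrite !tnth_mktuple.
by apply: eq_from_tnth => i; rewrite !tnth_mktuple; exact: xy.
Qed.

Lemma iter_left_shift k (x : nat -> chi) i :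
  iter k (@left_shift chi) x i = x (i + k)%N.
Proof.
by elim: k i => [|k IH] i; rewrite ?addn0// iterS /left_shift IH addSnnS.
Qed.

Lemma measurable_cylinder n (w : n.-tuple chi) :
  measurable (cylinder w : set (seq_space chi)).
Proof. by apply: sub_sigma_algebra; exists n, w. Qed.

(** Each [F w] is either all of [cylinder w] or empty, so [A] is a countable union of cylinders. *)
Lemma measurable_init_word_closed n (A : set (seq_space chi)) :
  (forall x y, init_word n x = init_word n y -> A x -> A y) -> measurable A.
Proof.
move=> hA.
pose F (w : n.-tuple chi) : set (seq_space chi) := [set x | cylinder w x /\ A x].
have -> : A = \bigcup_w F w.
  apply/seteqP; split=> [x Ax|x [w _ []]//].
  by exists (init_word n x).
apply: countable_bigcupT_measurable; first exact: countable_words.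
move=> w; have [[y [yw Ay]]|Fw0] := pselect (F w !=set0).
  have -> : F w = cylinder w; last exact: measurable_cylinder.
  apply/seteqP; split => [x []//|x xw]; split => //.
  by apply: hA Ay; rewrite xw.
have -> : F w = set0; last exact: measurable0.
by apply/seteqP; split=> // x Fx; apply: Fw0; exists x.
Qed.

Lemma measurable_shift_cylinder k n (w : n.-tuple chi) :
  measurable (iter k (@left_shift chi) @^-1` cylinder w : set (seq_space chi)).
Proof.
apply: (@measurable_init_word_closed (n + k)) => x y /init_wordP xy /=.
rewrite /cylinder /= => <-; apply/init_wordP => i iN.
by rewrite !iter_left_shift xy// ltn_add2r.
Qed.

Lemma trivIset_cylinder n : trivIset setT (@cylinder chi n).
Proof. by move=> u v _ _ [x [<- <-]]. Qed.

End words.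

(** * The divergence as a matching probability *)

Section divergence.
Variables (R : realType) (chi : pointedType).
Hypothesis chi_countable : countable [set: chi].

Lemma stationary_iter (mu : probability (seq_space chi) R) k n (w : n.-tuple chi) :
  stationary mu -> mu (iter k (@left_shift chi) @^-1` cylinder w) = mu (cylinder w).
Proof.
move=> mu_st; elim: k => // k IH.
rewrite -IH -[RHS]mu_st; last exact: measurable_shift_cylinder.
by congr (mu _); apply/funext => x; rewrite /preimage /mkset iterSr.
Qed.

(** Otherwise the whole space would be a countable union of null cylinders. *)
Lemma cylinder_charged (mu : probability (seq_space chi) R) n :
  exists w : n.-tuple chi, 0 < mu (cylinder w).
Proof.
apply: contrapT => /forallNP mu0.
have : mu setT = 0; last by rewrite probability_setT => /eqP; rewrite onee_eq0.
have -> : setT = \bigcup_w @cylinder chi n w.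
  by apply/seteqP; split=> // x _; exists (init_word n x).
rewrite measure_countable_bigcup.
- apply: esum1 => w _; apply/eqP; rewrite eq_le measure_ge0 andbT leNgt.
  exact/negP/mu0.
- exact: countable_words.
- by move=> w; exact: measurable_cylinder.
- exact: trivIset_cylinder.
Qed.

(** Deviation events are unions of these. When [nu] is stationary their probability does not depend
    on [k]; it is the divergence at [m]. *)
Definition matches (k m : nat) : set (seq_space chi * seq_space chi) :=
  [set xy | init_word m xy.1 = init_word m (iter k (@left_shift chi) xy.2)].

Lemma matchesE k m : matches k m = \bigcup_(w : m.-tuple chi)
  (cylinder w `*` (iter k (@left_shift chi) @^-1` cylinder w)).
Proof.
apply/seteqP; split => [[x y] /= xy|[x y] [w _ [/= <- xy]]//].
by exists (init_word m x).
Qed.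

Lemma measurable_matches k m : measurable (matches k m).
Proof.
rewrite matchesE; apply: countable_bigcupT_measurable; first exact: countable_words.
move=> w; apply: measurableX; first exact: measurable_cylinder.
exact: measurable_shift_cylinder.
Qed.

Lemma matches_nonincreasing k m n : (m <= n)%N -> matches k n `<=` matches k m.
Proof.
move=> mn [x y] /init_wordP xy; apply/init_wordP => i im.
by apply: xy; exact: leq_trans mn.
Qed.

Variables mu nu : probability (seq_space chi) R.

Lemma product_measure_rectangles (I : choiceType) (F G : I -> set (seq_space chi)) :
  countable [set: I] -> (forall i, measurable (F i)) ->
  (forall i, measurable (G i)) -> trivIset setT F ->
  (mu \x nu) (\bigcup_i (F i `*` G i)) = \esum_(i in [set: I]) (mu (F i) * nu (G i)).
Proof.
move=> cI mF mG tF; transitivity (\esum_(i in [set: I]) (mu \x nu) (F i `*` G i)).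
  apply: measure_countable_bigcup => //; first by move=> i; exact: measurableX.
  move=> i j _ _ [[x y] [[/= Fi _] [/= Fj _]]]; apply: tF => //; by exists x.
by apply: eq_esum => i _; exact: product_measure1E.
Qed.

Lemma product_measure_matches k m : stationary nu ->
  (mu \x nu) (matches k m) = divergence mu nu m.
Proof.
move=> nu_st; rewrite matchesE product_measure_rectangles.
- by apply: eq_esum => w _; rewrite stationary_iter.
- exact: countable_words.
- by move=> w; exact: measurable_cylinder.
- by move=> w; exact: measurable_shift_cylinder.
- exact: trivIset_cylinder.
Qed.

Lemma product_measure_le1 A : measurable A -> (mu \x nu) A <= 1.
Proof.
move=> mA; apply: (@le_trans _ _ ((mu \x nu) setT)).
  by apply: le_measure; rewrite ?inE//; exact: measurableT.
rewrite -setXTT product_measure1E//; try exact: measurableT.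
have : mu setT * nu setT <= 1 by rewrite !probability_setT mule1.
by [].
Qed.

Hypothesis nu_stationary : stationary nu.

(** Both sides are probabilities of matching events at shift [0], and these events are nested. *)
Lemma divergence_nonincreasing m n : (m <= n)%N ->
  divergence mu nu n <= divergence mu nu m.
Proof.
move=> mn; rewrite -!(product_measure_matches 0)//.
apply: le_measure; rewrite ?inE; try exact: measurable_matches.
exact: matches_nonincreasing.
Qed.

Lemma divergence_le1 m : divergence mu nu m <= 1.
Proof.
rewrite -(product_measure_matches 0)//; apply: product_measure_le1.
exact: measurable_matches.
Qed.

Lemma divergence_gt0 m : complete_grammar nu -> 0 < divergence mu nu m.
Proof.
(* Complete grammar speaks of nonempty words, so length [m + 1] is used in order to cover
   [m = 0]. *)
move=> nu_c; apply: lt_le_trans (divergence_nonincreasing _ _ (leqnSn m)).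
have [w w0] := cylinder_charged mu m.+1.
apply: (@lt_le_trans _ _ (mu (cylinder w) * nu (cylinder w))).
  by apply: mule_gt0 => //; exact: nu_c.
apply: esum_ge; exists [set w]; first by split.
by rewrite fsbig_set1.
Qed.

(** If both cylinders are charged, this is the definition of [psi_plus] cleared of denominators.
    Otherwise the left side is null, being at most the measure of either cylinder, by stationarity
    for the shifted one. *)
Lemma psi_plus_bound (m : probability (seq_space chi) R) (g i j : nat) (p : R)
    (w : i.-tuple chi) (xi : j.-tuple chi) :
  stationary m -> (0 <= p)%R -> psi_plus m g i j <= p%:E ->
  m (cylinder w `&` (iter (i + g) (@left_shift chi) @^-1` cylinder xi)) <=
  p%:E * (m (cylinder w) * m (cylinder xi)).
Proof.
move=> m_st p0 psi_le.
set S := iter _ _ @^-1` _.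
have mS : measurable (S : set (seq_space chi)) by exact: measurable_shift_cylinder.
have mw : measurable (cylinder w : set (seq_space chi)) by exact: measurable_cylinder.
have mWw : m (cylinder w `&` S) <= m (cylinder w).
  by apply: le_measure; rewrite ?inE//; exact: measurableI.
have mWxi : m (cylinder w `&` S) <= m (cylinder xi).
  rewrite -(stationary_iter _ (i + g) _ xi m_st).
  by apply: le_measure; rewrite ?inE//; exact: measurableI.
have [w0|w0] := leP (m (cylinder w)) 0.
  apply: (le_trans (le_trans mWw w0)).
  by apply: mule_ge0; rewrite ?lee_fin// mule_ge0.
have [xi0|xi0] := leP (m (cylinder xi)) 0.
  apply: (le_trans (le_trans mWxi xi0)).
  by apply: mule_ge0; rewrite ?lee_fin// mule_ge0.
have : cond_proba m S (cylinder w) / m (cylinder xi) <= p%:E.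
  apply: le_trans psi_le; apply: ereal_sup_ubound.
  by exists w, xi.
rewrite /cond_proba setIC.
have real A : measurable A -> exists r, m A = r%:E.
  by move=> mA; exists (fine (m A)); rewrite fineK// fin_num_measure.
have [a ->] := real _ (measurableI _ _ mw mS).
have [c cE] := real _ mw; have [b bE] := real _ (measurable_cylinder _ _ xi).
rewrite {}cE in w0 *; rewrite {}bE in xi0 *.
rewrite !lte_fin in w0 xi0.
rewrite !inver !gt_eqF// -!EFinM !lee_fin.
by rewrite !ler_pdivrMr// => /le_trans; apply; rewrite -mulrA (mulrC c).
Qed.

(** Sequences agreeing on [i + g + j] letters lie in a common [W u], the pair [u] recording the
    first [i] and the last [j] letters. The squares of the [W u] are disjoint, and [p] is paid once
    for [mu] and once for [nu]. *)
Lemma divergence_submultiplicative (g i j : nat) (p : R) : stationary mu ->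
  (0 <= p)%R -> psi_plus_max mu nu g i j <= p%:E ->
  divergence mu nu (i + g + j) <=
    (p ^+ 2)%:E * (divergence mu nu i * divergence mu nu j).
Proof.
move=> mu_st p0; rewrite ge_max => /andP[mup nup].
pose W (u : i.-tuple chi * j.-tuple chi) : set (seq_space chi) :=
  cylinder u.1 `&` (iter (i + g) (@left_shift chi) @^-1` cylinder u.2).
have mW u : measurable (W u).
  by apply: measurableI; [exact: measurable_cylinder|exact: measurable_shift_cylinder].
have tW : trivIset setT W.
  move=> [u1 u2] [v1 v2] _ _ [x [[/= xu1 xu2] [/= xv1 xv2]]].
  by congr (_, _); [rewrite -xu1 -xv1|rewrite -xu2 -xv2].
have PU := product_measure_rectangles _ W W
  (countable_word_pairs _ chi_countable i j) mW mW tW.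
rewrite -(product_measure_matches 0)//.
apply: (@le_trans _ _ ((mu \x nu) (\bigcup_u (W u `*` W u)))).
  apply: le_measure; rewrite ?inE//; first exact: measurable_matches.
    apply: countable_bigcupT_measurable; first exact: countable_word_pairs.
    by move=> u; exact: measurableX.
  move=> [x y] /init_wordP /= xy.
  exists (init_word i x, init_word j (iter (i + g) (@left_shift chi) x)) => //.
  split; split => //=; apply/init_wordP => k kN.
    by rewrite xy//; lia.
  by rewrite !iter_left_shift xy//; lia.
have Efin k : divergence mu nu k \is a fin_num.
  by rewrite ge0_fin_numE ?(le_lt_trans (divergence_le1 k)) ?ltry// esum_ge0// => w _;
    rewrite mule_ge0.
rewrite PU.
pose A k (w : k.-tuple chi) := mu (cylinder w) * nu (cylinder w).
have A0 k w : 0 <= A k w by rewrite /A mule_ge0.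
have Afin k w : A k w \is a fin_num.
  by rewrite /A fin_numM// fin_num_measure//; exact: measurable_cylinder.
apply: (@le_trans _ _ (\esum_(u in [set: i.-tuple chi] `*`` fun=> [set: j.-tuple chi])
   ((p ^+ 2)%:E * (A i u.1 * A j u.2)))).
  rewrite (_ : _ `*`` _ = setT); last by apply/seteqP; split.
  apply: le_esum => -[w xi] _.
  have -> : (p ^+ 2)%:E * (A i w * A j xi) =
    (p%:E * (mu (cylinder w) * mu (cylinder xi))) *
    (p%:E * (nu (cylinder w) * nu (cylinder xi))).
    by rewrite /A expr2 EFinM [RHS]muleACA; congr (_ * _); exact: muleACA.
  by apply: lee_pmul => //; exact: psi_plus_bound.
rewrite -(@esum_esum _ _ _ _ _ (fun w xi => (p ^+ 2)%:E * (A i w * A j xi))); last first.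
  by move=> w xi _ _; rewrite !mule_ge0// lee_fin exprn_ge0.
(* The double sum factors: the inner sum over [xi] yields the divergence at [j], then the outer one
   yields that at [i]. *)
apply: (@le_trans _ _ (\esum_(w in [set: i.-tuple chi])
   ((p ^+ 2 * fine (divergence mu nu j))%:E * A i w))).
  apply: le_esum => w _.
  have -> : (p ^+ 2 * fine (divergence mu nu j))%:E * A i w =
     (p ^+ 2 * fine (A i w))%:E * divergence mu nu j.
    by rewrite (EFinM _ (fine (divergence _ _ _))) (EFinM _ (fine (A _ _)))
      !fineK// muleAC.
  under eq_esum do rewrite muleA -(fineK (Afin i w)) -EFinM.
  apply: esumZl_le => //.
  by rewrite mulr_ge0 ?exprn_ge0// fine_ge0.
apply: le_trans (esumZl_le _ _ _ _ _ _) _ => //.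
  by rewrite mulr_ge0 ?exprn_ge0// fine_ge0// esum_ge0// => w _; exact: A0.
by rewrite EFinM fineK// -muleA (muleC (divergence _ _ j)).
Qed.

End divergence.

(** * Deviations of the shortest path *)

Section shortest_path.
Variables (R : realType) (chi : pointedType).
Implicit Types x y : nat -> chi.

(** The cylinders fix the positions below [n] and those from [k] to [k + n - 1], so only the [n - k]
    common positions can conflict. *)
Lemma overlapP (n k : nat) x y : (k <= n)%N ->
  cylinder (init_word n y) `&`
    (iter k (@left_shift chi) @^-1` cylinder (init_word n x)) !=set0 <->
  matches chi k (n - k) (x, y).
Proof.
move=> kn; rewrite /cylinder /matches; split=> [[z [/= zy zx]]|/= xy].
  move: zy zx => /init_wordP zy /init_wordP zx; apply/init_wordP => i ik.
  by rewrite -zx ?iter_left_shift ?zy//; lia.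
move: xy => /init_wordP xy.
(* Glue the first [k] letters of [y] to the whole of [x]. *)
exists (fun i => if (i < k)%N then y i else x (i - k)%N); split=> /=.
  apply/init_wordP => i iN; case: ltnP => // ki.
  by rewrite xy ?iter_left_shift ?subnK// ltn_sub2r//; lia.
apply/init_wordP => i iN; rewrite iter_left_shift addnK ifF//.
by apply/negbTE; rewrite -leqNgt leq_addl.
Qed.

Lemma shortest_path_lt (n : nat) x y (c : R) : (0 < n)%N ->
  (shortest_path R n x y < c)%R <->
  exists k, [/\ (1 <= k)%N, (k%:R < c)%R &
    cylinder (init_word n y) `&`
      (iter k (@left_shift chi) @^-1` cylinder (init_word n x)) !=set0].
Proof.
move=> n0; split.
  move=> /inf_lt[]; last by move=> _ [k [k1 kN] <-] kc; exists k.
  (* The shift [k = n] is always admissible, its overlap being empty, so the infimum is over a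
     nonempty set and no default value occurs. *)
  exists n%:R, n => //; split => //; apply/overlapP => //.
  by apply/init_wordP => i; rewrite subnn.
move=> [k [k1 kc kN]]; apply: le_lt_trans kc.
by apply: ge_inf; [exists 0%R => _ [j _ <-]|exists k].
Qed.

(* [k < (1 - eps) n] amounts to [n - k > eps n], that is to
   [n - k >= trunc (eps n) + 1]. *)
Lemma deviation_eventE (eps : R) (n : nat) (m := (Num.trunc (eps * n%:R)).+1) :
  (0 < eps)%R -> (0 < n)%N ->
  [set xy : seq_space chi * seq_space chi |
     (shortest_path R n xy.1 xy.2 / n%:R < 1 - eps)%R] =
  \bigcup_(k in [set k | (1 <= k)%N /\ (k + m <= n)%N]) matches chi k (n - k).
Proof.
move=> eps0 n0; have nR : (0 < n%:R :> R)%R by rewrite ltr0n.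
have kmE k : ((k%:R < (1 - eps) * n%:R)%R <-> (k + m <= n)%N).
  have e : (0 <= eps * n%:R)%R by rewrite mulr_ge0// ltW.
  have [kn|nk] := leqP k n.
    have -> : (k + m <= n)%N = (Num.trunc (eps * n%:R) < n - k)%N by rewrite /m; lia.
    by rewrite truncn_lt_nat// natrB//; split=> ?; lra.
  split; last by move=> h; exfalso; move: h nk; rewrite /m; lia.
  by move: nk => /ltnW; rewrite -(ler_nat R) => nk kn; exfalso; lra.
apply/seteqP; split=> [[x y]|[x y] [k [k1 /kmE kn] xy]] /=; rewrite ltr_pdivrMr//.
  move=> /(shortest_path_lt _ _ _ _ n0)[k [k1 /kmE kn kN]].
  by exists k => //; apply/overlapP => //; lia.
apply/shortest_path_lt => //; exists k; split => //; apply/overlapP => //.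
by move/kmE : kn; lia.
Qed.

End shortest_path.

(** * Logarithmic form of the bounds *)

Section rates.
Variables (R : realType) (chi : pointedType).
Hypothesis chi_countable : countable [set: chi].
Variables mu nu : probability (seq_space chi) R.
Hypothesis mu_stationary : stationary mu.
Hypothesis nu_stationary : stationary nu.
Hypothesis nu_complete : complete_grammar nu.

Let div_gt0 k : 0 < divergence mu nu k.
Proof. exact: divergence_gt0. Qed.

Lemma divergence_fin_num k : divergence mu nu k \is a fin_num.
Proof.
rewrite ge0_fin_numE; last exact: ltW.
by rewrite (le_lt_trans (divergence_le1 _ _ _ _ _ _ _)) ?ltry.
Qed.

Lemma divergence_EFin k : divergence mu nu k = (fine (divergence mu nu k))%:E.
Proof. by rewrite fineK// divergence_fin_num. Qed.

Lemma fine_divergence_gt0 k : (0 < fine (divergence mu nu k))%R.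
Proof. by rewrite -lte_fin -divergence_EFin. Qed.

(** Under complete grammar the divergence lies in [(0, 1]], so this is a genuine nonnegative real
    and no default value of [fine] or [ln] is met. *)
Definition log_divergence (k : nat) : R := (- ln (fine (divergence mu nu k)))%R.

Lemma rate_seqE k : rate_seq mu nu k = (log_divergence k / k%:R)%:E.
Proof.
rewrite /rate_seq divergence_EFin lne_EFin ?fine_divergence_gt0//.
by rewrite -EFinM -EFinN /log_divergence mulNr mulrC.
Qed.

Lemma log_divergence_ge0 k : (0 <= log_divergence k)%R.
Proof.
rewrite oppr_ge0; apply: ln_le0.
by rewrite -lee_fin -divergence_EFin; exact: divergence_le1.
Qed.

Lemma log_divergence_homo :
  {homo log_divergence : m n / (m <= n)%N >-> (m <= n)%R}.
Proof.
move=> m n mn; rewrite lerN2 ler_ln ?posrE ?fine_divergence_gt0//.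
by rewrite -lee_fin -!divergence_EFin; exact: divergence_nonincreasing.
Qed.

Lemma log_divergence_gapped (g i j : nat) (B : R) :
  lne (psi_plus_max mu nu g i j) <= B%:E ->
  (log_divergence i + log_divergence j - 2 * B <= log_divergence (i + g + j))%R.
Proof.
move=> psiB.
have psi_le : psi_plus_max mu nu g i j <= (expR B)%:E.
  (* The value [+oo] is excluded because [B] is finite; values that are not positive lie below
     [expR B] anyway. *)
  move: psiB; case: (psi_plus_max _ _ _ _ _) => [r| |] /=;
    [|by rewrite leye_eq|by rewrite !leNye].
  rewrite lee_fin; case: ifPn => [r0 _|]; first by rewrite (le_trans r0)// expR_ge0.
  rewrite -ltNge => r0; rewrite lee_fin => rB.
  by rewrite -(@lnK _ r) ?posrE// ler_expR.
have := divergence_submultiplicative _ _ chi_countable _ _ nu_stationary _ _ _ _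
  mu_stationary (expR_ge0 B) psi_le.
rewrite (divergence_EFin i) (divergence_EFin j) (divergence_EFin (i + g + j)).
have := fine_divergence_gt0 i; have := fine_divergence_gt0 j.
have := fine_divergence_gt0 (i + g + j); rewrite /log_divergence.
set a := fine _; set b := fine _; set c := fine _ => a0 b0 c0.
rewrite -!EFinM lee_fin => h.
have p0 : (0 < expR B ^+ 2)%R by rewrite exprn_gt0// expR_gt0.
have cb0 : (0 < c * b)%R by exact: mulr_gt0.
have : (ln a <= ln (expR B ^+ 2 * (c * b)))%R by rewrite ler_ln ?posrE// mulr_gt0.
rewrite lnM ?posrE// lnM ?posrE//.
by rewrite lnXn ?expR_gt0// expRK mulr2n; lra.
Qed.

Lemma deviation_probability_bounds (eps : R) (n : nat)
    (m := (Num.trunc (eps * n%:R)).+1)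
    (B := [set xy : seq_space chi * seq_space chi |
       (shortest_path R n xy.1 xy.2 / n%:R < 1 - eps)%R]) :
  (0 < eps)%R -> (m < n)%N ->
  divergence mu nu m <= (mu \x nu) B <= n%:R%:E * divergence mu nu m.
Proof.
move=> eps0 mn; have n0 : (0 < n)%N by lia.
have BE := deviation_eventE _ chi _ _ eps0 n0; rewrite -/B -/m in BE.
have mB : measurable B.
  by rewrite BE; apply: bigcup_measurable => k _; exact: measurable_matches.
apply/andP; split.
  (* Lower bound: the single shift [n - m], positive as [m < n], leaves exactly [m] letters to
     match. *)
  rewrite -(product_measure_matches _ _ _ _ _ (n - m))//.
  apply: le_measure; rewrite ?inE//; first exact: measurable_matches.
  rewrite BE; apply: subset_trans; last first.
    by apply: (@bigcup_sup _ _ (n - m)%N) => /=; lia.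
  by rewrite subKn// ltnW.
(* Upper bound: every admissible shift is below [n] and leaves at least [m] letters to match. *)
apply: (@le_trans _ _ ((mu \x nu) (\big[setU/set0]_(k < n) matches chi k m))).
  apply: le_measure; rewrite ?inE//.
    by apply: bigsetU_measurable => k _; exact: measurable_matches.
  rewrite BE => xy [k [k1 kmn] xyk].
  suff : (\bigcup_(j < n) matches chi j m) xy by rewrite bigcup_mkord.
  exists k => /=; first by lia.
  by apply: matches_nonincreasing xyk; lia.
have mM k : (k < n)%N -> measurable (matches chi k m).
  by move=> _; exact: measurable_matches.
apply: (le_trans (Boole_inequality (mu \x nu) mM)).
apply: (@le_trans _ _ (\sum_(k < n) divergence mu nu m)).
  by apply: lee_sum => k _; rewrite -(product_measure_matches _ _ _ _ _ k).
by rewrite divergence_EFin sumEFin sumr_const card_ord -EFinM mulr_natl.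
Qed.

(** Here [D = - ln P] for the deviation probability [P], which lies in [(0, 1]]; the factor [n] of
    the union bound becomes [ln n]. *)
Lemma deviation_seqE (eps : R) (n : nat) (m := (Num.trunc (eps * n%:R)).+1) :
  (0 < eps)%R -> (m < n)%N ->
  exists2 D : R, deviation_seq mu nu eps n = (D / n%:R)%:E &
    (log_divergence m - ln n%:R <= D <= log_divergence m)%R.
Proof.
move=> eps0 mn.
have := deviation_probability_bounds _ _ eps0 mn; rewrite -/m.
rewrite /deviation_seq; set P := (mu \x nu) _ => /andP[EP PE].
have := fine_divergence_gt0 m; have := divergence_EFin m; have := log_divergence_ge0 m.
rewrite /log_divergence; set e := fine _ => e1 eE e0.
have P_le1 : P <= 1.
  apply: product_measure_le1 => //.
  rewrite deviation_eventE//; last by lia.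
  by apply: bigcup_measurable => k _; exact: measurable_matches.
have Pfin : P \is a fin_num.
  by rewrite ge0_fin_numE ?(le_lt_trans P_le1) ?ltry// (le_trans _ EP)// ltW.
move: EP PE P_le1; rewrite -(fineK Pfin) eE -EFinM !lee_fin => EP PE P_le1.
set p := fine P in EP PE P_le1 *.
have p0 : (0 < p)%R by exact: lt_le_trans EP.
have n0 : (0 < n%:R :> R)%R by rewrite ltr0n; lia.
exists (- ln p)%R.
  rewrite lne_EFin//= -EFinM; congr (_%:E).
  by rewrite ler0_norm ?ln_le0// mulrC.
have : (ln e <= ln p)%R by rewrite ler_ln.
have : (ln p <= ln n%:R + ln e)%R.
  by rewrite -lnM ?posrE// ler_ln ?posrE// mulr_gt0.
by move=> ? ?; apply/andP; split; lra.
Qed.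

End rates.

Theorem corollary4p1 (R : realType) (chi : pointedType)
    (chi_countable : countable [set: chi])
    (mu nu : probability (seq_space chi) R)
    (mu_stationary : stationary mu) (nu_stationary : stationary nu)
    (eps : R) (eps_gt0 : (0 < eps)%R) (eps_lt1 : (eps < 1)%R)
    (psi_bound : exists (g : nat) (K delta : R),
      [/\ (0 < K)%R, (0 < delta)%R &
          forall i j : nat, (1 <= i)%N -> (1 <= j)%N ->
            lne (psi_plus_max mu nu g i j) <=
              (K * ((i + j)%:R / ln ((i + j)%:R) `^ (1 + delta)))%:E])
    (nu_complete : complete_grammar nu) :
  [/\ cvgn (rate_seq mu nu),
      cvgn (deviation_seq mu nu eps) &
      lower_deviation_rate mu nu eps = eps%:E * limiting_rate mu nu].
Proof.
have [g [K [delta [K0 delta0 psi_le]]]] := psi_bound.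
pose f := log_divergence R chi mu nu.
have rateE : rate_seq mu nu = (fun n => (f n / n%:R)%:E).
  by apply/funext => n; exact: rate_seqE.
have rate_cvg : cvgn (rate_seq mu nu).
  (* The constant is doubled because [psi] enters squared. *)
  rewrite rateE; apply: (@gapped_superadditive_cvg _ f g (2 * K)%R delta) => //.
  - by rewrite mulr_ge0// ltW.
  - by move=> n; exact: log_divergence_ge0.
  - by move=> m n; exact: log_divergence_homo.
  - move=> i j i1 j1; rewrite -mulrA.
    exact: log_divergence_gapped (psi_le _ _ i1 j1).
(* As [eps < 1], one has [eps n + 1 < n] as soon as [n >= 2 / (1 - eps)]. *)
have mn : \forall n \near \oo, ((Num.trunc (eps * n%:R)).+1 < n)%N.
  near=> n.
  have n2 : (2 / (1 - eps) <= n%:R)%R by near: n; exact: near_ge_nat.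
  rewrite -(ltr_nat R) -natr1.
  have /andP[+ _] := @truncn_itv R (eps * n%:R) (mulr_ge0 (ltW eps_gt0) (ler0n _ _)).
  move: n2; rewrite ler_pdivrMr ?subr_gt0//; lra.
(* For large [n] the deviation sequence is real, and this recovers the witness of [deviation_seqE]
   as a function of [n]. *)
pose D n := (fine (deviation_seq mu nu eps n) * n%:R)%R.
have DE : \forall n \near \oo, deviation_seq mu nu eps n = (D n / n%:R)%:E /\
    (f (Num.trunc (eps * n%:R)).+1 - ln n%:R <= D n <= f (Num.trunc (eps * n%:R)).+1)%R.
  near=> n.
  have mn_n : ((Num.trunc (eps * n%:R)).+1 < n)%N by near: n.
  have n0 : (n%:R != 0 :> R)%R by rewrite pnatr_eq0; lia.
  have [d dE df] := deviation_seqE _ _ chi_countable mu nu nu_stationary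
    nu_complete _ _ eps_gt0 mn_n.
  by rewrite /D dE /= divfK.
have dev_cvg : deviation_seq mu nu eps n @[n --> \oo] --> eps%:E * limiting_rate mu nu.
  have : (D n / n%:R)%:E @[n --> \oo] --> eps%:E * limiting_rate mu nu.
    apply: (@cvg_fraction _ f D) => //; first by rewrite -rateE.
    by apply: filterS DE => n [].
  by apply: cvg_trans; apply: near_eq_cvg; apply: filterS DE => n [].
split => //; first by apply/cvg_ex; eexists; exact: dev_cvg.
exact/cvg_lim.
Unshelve. all: by end_near. Qed.
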